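(* Given $A,B\in\mathbb{C}^{n\times n}$ and an integer $p\ge 1$, let $[\widetilde A_p,\widetilde B_p]=\mathbf{IRS}(A,B,p)$ be computed on a floating-point machine with precision $\mathbf{u}$ (as described in the context). Let $\epsilon\in(0,1)$, let $\kappa_{\mathrm{IRS}}(A,B,p)$ be the condition number defined in the context, and let $\mu(n)=\max\{\mu_{\mathrm{MM}}(n),\mu_{\mathrm{QR}}(n),\sqrt n\}$. Suppose $$\mathbf{u}\le \frac{\epsilon}{324\,\mu(n)\,\kappa_{\mathrm{IRS}}(A,B,p)\,\max\{p^2+4p-5,\,1\}} .$$ Then there exist matrices $\mathring A_p,\mathring B_p\in\mathbb{C}^{n\times n}$ such that $\mathring A_p^{-1}\mathring B_p=(A^{-1}B)^{2^p}$ and $$\|\widetilde A_p-\mathring A_p\|_2\le \epsilon\left\|\begin{pmatrix} A \\ B \end{pmatrix}\right\|_2,\qquad \|\widetilde B_p-\mathring B_p\|_2\le \epsilon\left\|\begin{pmatrix} A \\ B \end{pmatrix}\right\|_2 .$$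
   Context: $\|\cdot\|_2$ is the spectral norm; $\sigma_{\min}$ is the smallest singular value (of a tall matrix $D$: the square root of the smallest eigenvalue of $D^HD$); $X^H$ is the Hermitian transpose of $X$. Floating-point model: each basic operation $\circ\in\{+,-,\times,\div\}$ satisfies $fl(x\circ y)=(x\circ y)(1+\Delta)$ with $|\Delta|\le\mathbf{u}$, where $\mathbf u$ is the machine precision. One has the following black-box algorithms, with $\mu_{\mathrm{MM}}(n),\mu_{\mathrm{QR}}(n)$ (low-degree) polynomials in $n$. (1) Matrix multiplication: $\mathbf{MM}(X,Y)$ for $X,Y\in\mathbb{C}^{n\times n}$ returns a matrix with $\|\mathbf{MM}(X,Y)-XY\|_2\le\mu_{\mathrm{MM}}(n)\mathbf{u}\|X\|_2\|Y\|_2$. (2) Full QR: for $X\in\mathbb{C}^{2n\times n}$, $[Q,R]=\mathbf{QR}(X)$ with $Q\in\mathbb{C}^{2n\times 2n}$ and $R\in\mathbb{C}^{2n\times n}$ exactly upper triangular, and there exist $X'\in\mathbb{C}^{2n\times n}$ and a unitary $Q'\in\mathbb{C}^{2n\times 2n}$ with $X'=Q'R$, $\|Q'-Q\|_2\le\mu_{\mathrm{QR}}(n)\mathbf{u}$ and $\|X'-X\|_2\le\mu_{\mathrm{QR}}(n)\mathbf{u}\|X\|_2$. Floating-point $\mathbf{IRS}(A,B,p)$ (Implicit Repeated Squaring, a routine for repeatedly squaring the product $A^{-1}B$ without forming it): set $\widetilde A_0=A$, $\widetilde B_0=B$. For $j=0,\dots,p-1$: compute $[Q,R]=\mathbf{QR}\begin{pmatrix}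 \widetilde B_j \\ -\widetilde A_j \end{pmatrix}$, partition $Q=\begin{pmatrix} Q_{11} & Q_{12} \\ Q_{21} & Q_{22} \end{pmatrix}$ into $n\times n$ blocks, and set $\widetilde A_{j+1}=\mathbf{MM}(Q_{12}^H,\widetilde A_j)$, $\widetilde B_{j+1}=\mathbf{MM}(Q_{22}^H,\widetilde B_j)$. The output is $\widetilde A_p,\widetilde B_p$. Condition number: let $D^p_{(A,B)}\in\mathbb{C}^{2^pn\times(2^p-1)n}$ be the block matrix (with $n\times n$ blocks) whose $j$-th block column, $1\le j\le 2^p-1$, has $B$ in block row $j$, $-A$ in block row $j+1$, and zeros elsewhere. Then $$\kappa_{\mathrm{IRS}}(A,B,p)=\sigma_{\min}(D^p_{(A,B)})^{-1}\left\|\begin{pmatrix} A \\ B \end{pmatrix}\right\|_2 .$$ *)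

(* Defs.v *)
From HB Require Import structures.
From mathcomp Require Import all_boot all_order all_algebra.
From mathcomp Require Import sesquilinear spectral.
From mathcomp Require Import complex.
From mathcomp Require Import boolp classical_sets reals.

Set Implicit Arguments.
Unset Strict Implicit.
Unset Printing Implicit Defensive.

Import Order.TTheory GRing.Theory Num.Theory.
Import ComplexField.Normc.
Local Open Scope ring_scope.
Local Open Scope complex_scope.
Local Open Scope sesquilinear_scope.
Local Open Scope classical_set_scope.

Section Norms.
Variable R : realType.

Definition vnorm m (v : 'cV[R[i]]_m) : R :=
  Num.sqrt (\sum_i (normc (v i 0)) ^+ 2).

(* The supremum is that of a nonempty set (v = 0 belongs to it), bounded since
   the dimension is finite. *)
Definition spec_norm m n (X : 'M[R[i]]_(m, n)) : R :=
  sup [set vnorm (X *m v) | v in [set v : 'cV[R[i]]_n | vnorm v <= 1]].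

(* D^H D is Hermitian, so all its eigenvalues are real; for n > 0 they form a
   finite nonempty set, whose infimum is its least element. *)
Definition sigma_min m n (D : 'M[R[i]]_(m, n)) : R :=
  Num.sqrt (inf [set l : R | eigenvalue (D^t* *m D) l%:C]).

End Norms.

Section FloatingPoint.
Variable R : realType.

Inductive arith_op := OpAdd | OpSub | OpMul | OpDiv.

Definition exact_op (o : arith_op) (x y : R[i]) : R[i] :=
  match o with
  | OpAdd => x + y
  | OpSub => x - y
  | OpMul => x * y
  | OpDiv => x / y
  end.

Definition fp_arith (u : R) (fl : arith_op -> R[i] -> R[i] -> R[i]) : Prop :=
  forall o x y, (o = OpDiv -> y != 0) ->
  exists2 delta : R[i], normc delta <= u &
    fl o x y = exact_op o x y * (1 + delta).

Definition MM_accurate n (u mu : R)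
    (MM : 'M[R[i]]_n -> 'M[R[i]]_n -> 'M[R[i]]_n) : Prop :=
  forall X Y,
    spec_norm (MM X Y - X *m Y) <= mu * u * spec_norm X * spec_norm Y.

Definition QR_accurate n (u mu : R)
    (QR : 'M[R[i]]_(n + n, n) -> 'M[R[i]]_(n + n) * 'M[R[i]]_(n + n, n)) :
    Prop :=
  forall X, let: (Q, T) := QR X in
    (forall (i : 'I_(n + n)) (j : 'I_n), (j < i)%N -> T i j = 0) /\
    exists X' : 'M[R[i]]_(n + n, n), exists Q' : 'M[R[i]]_(n + n),
      [/\ Q' \is unitarymx, X' = Q' *m T,
          spec_norm (Q' - Q) <= mu * u
        & spec_norm (X' - X) <= mu * u * spec_norm X].

End FloatingPoint.

Section IRS.
Variables (R : realType) (n : nat).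
Local Notation M := 'M[R[i]]_n.
Variable MM : M -> M -> M.
Variable QR : 'M[R[i]]_(n + n, n) -> 'M[R[i]]_(n + n) * 'M[R[i]]_(n + n, n).

Definition IRS_step (AB : M * M) : M * M :=
  let Q := (QR (col_mx AB.2 (- AB.1))).1 in
  (MM ((ursubmx Q)^t*) AB.1, MM ((drsubmx Q)^t*) AB.2).

Definition IRS (A B : M) (p : nat) : M * M := iter p IRS_step (A, B).

End IRS.

Section Conditioning.
Variables (R : realType) (n : nat).
Implicit Types A B : 'M[R[i]]_n.

(* Block rows and block columns are numbered from 0. *)
Definition IRS_mx A B (p : nat) :=
  \mxblock_(i < (2 ^ p)%N, j < (2 ^ p - 1)%N)
    (if (i == j :> nat) then B else if (i == j.+1 :> nat) then - A else 0).

(* When D is rank deficient the condition number is infinite, but the value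
   below is 0, since 0^-1 = 0.  A bound u <= eps / (c * kappa_IRS A B p) then
   reads u <= 0: like the intended u <= eps / oo, no u > 0 satisfies it. *)
Definition kappa_IRS A B p : R :=
  (sigma_min (IRS_mx A B p))^-1 * spec_norm (col_mx A B).

(* For singular A the product A^-1 B is only formal: it stands for the linear
   relation of the pairs (x, y) with A y = B x, which is the graph of A^-1 B
   when A is invertible, and its powers are iterated compositions of this
   relation. *)
Definition quot_rel A B (x y : 'cV[R[i]]_n) : Prop := A *m y = B *m x.

Definition quot_rel_pow A B (N : nat) (x y : 'cV[R[i]]_n) : Prop :=
  exists z : nat -> 'cV[R[i]]_n,
    [/\ z 0%N = x, z N = y & forall k, (k < N)%N -> quot_rel A B (z k) (z k.+1)].

(* A'^-1 B' = (A^-1 B)^N: literally when A is invertible (A' must then be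
   invertible too), and as linear relations for arbitrary A. *)
Definition quot_pow_eq A B (N : nat) (A' B' : 'M[R[i]]_n) : Prop :=
  (A \in unitmx ->
     A' \in unitmx /\ invmx A' *m B' = (invmx A *m B) ^+ N) /\
  (forall x y, quot_rel A' B' x y <-> quot_rel_pow A B N x y).

End Conditioning.

(* Main.v *)
(* Write |X| for the spectral norm, s = |(A; B)|, d = mu u, D for the block matrix
   of the condition number and sigma for its least singular value.  Replacing every
   computed Q by the nearby exactly unitary Q', the steps multiply the initial
   pencil from the left by blocks W_0, ..., W_(2^p - 1) forming a matrix W with
   orthonormal rows, and the computed matrices are within 3 d s p of W_0 A and
   W_(2^p - 1) B.  In exact arithmetic W would annihilate D; here each squaring
   turns W D into two copies of the previous one around one new block column of
   norm O(d s k), so that |W D| <= 3 d s p^2.  Removing the component of W along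
   the range of D changes W by at most |W D| / sigma = 3 d p^2 kappa < 1, which
   leaves rows that are still independent and hence span the left kernel of D.
   Such a left kernel basis yields exact matrices W_0 A and W_(2^p - 1) B for
   (A^-1 B)^(2^p). *)
Require Import Defs.
From HB Require Import structures.
From mathcomp Require Import all_boot all_order all_algebra.
From mathcomp Require Import sesquilinear spectral.
From mathcomp Require Import complex.
From mathcomp Require Import boolp classical_sets reals.
From mathcomp Require Import ring lra.

Import Order.TTheory GRing.Theory Num.Theory.
Local Open Scope ring_scope.
Local Open Scope complex_scope.

Set Implicit Arguments.
Unset Strict Implicit.
Unset Printing Implicit Defensive.

(** * Cauchy-Schwarz and the Euclidean norm of complex matrices *)

Section EuclideanNorm.
Variable R : realType.
Local Notation C := R[i].
Local Notation normc := ComplexField.Normc.normc.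
Local Open Scope sesquilinear_scope.

(** The quadratic form sum of (t a_i - s b_i)^2 is nonnegative; its value at t = y, s = z gives the
    inequality when y > 0. *)
Lemma CauchySchwarz_sum (I : finType) (a b : I -> R) :
  \sum_i a i * b i
    <= Num.sqrt (\sum_i a i ^+ 2) * Num.sqrt (\sum_i b i ^+ 2).
Proof.
set x := \sum_i a i ^+ 2; set y := \sum_i b i ^+ 2; set z := \sum_i _.
have x0 : 0 <= x by apply: sumr_ge0 => i _; rewrite sqr_ge0.
have y0 : 0 <= y by apply: sumr_ge0 => i _; rewrite sqr_ge0.
have quad t s : 0 <= t ^+ 2 * x - 2%:R * t * s * z + s ^+ 2 * y.
  rewrite !mulr_sumr -sumrB -big_split/=; apply: sumr_ge0 => i _.
  by rewrite (_ : _ + _ = (t * a i - s * b i) ^+ 2) ?sqr_ge0//; ring.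
rewrite -sqrtrM//; have [z0|z0] := leP z 0; first exact: le_trans z0 (sqrtr_ge0 _).
rewrite -[z]ger0_norm ?(ltW z0)// -sqrtr_sqr; apply: ler_wsqrtr.
have [yx0|yn0] := eqVneq y 0.
  (* For y = 0 the form is linear in s, and this s makes it equal to x - (x + 1) < 0, which
     contradicts z > 0. *)
  have := quad 1 ((x + 1) / (2%:R * z)); rewrite yx0 mulr0 addr0 expr1n mul1r.
  have -> : 2%:R * 1 * ((x + 1) / (2%:R * z)) * z = x + 1.
    by field; rewrite gt_eqF.
  lra.
have yp : 0 < y by rewrite lt_neqAle eq_sym yn0.
have := quad y z.
suff -> : y ^+ 2 * x - 2%:R * y * z * z + z ^+ 2 * y = y * (x * y - z ^+ 2).
  by rewrite pmulr_rge0// subr_ge0.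
ring.
Qed.

(** The Frobenius norm: on rows and columns alike it is the Euclidean norm, and on matrices it is a
    crude bound for the spectral norm. *)
Definition fnorm m n (X : 'M[C]_(m, n)) : R :=
  Num.sqrt (\sum_i \sum_j normc (X i j) ^+ 2).

Lemma fnorm_ge0 m n (X : 'M[C]_(m, n)) : 0 <= fnorm X.
Proof. exact: sqrtr_ge0. Qed.

Lemma fnorm2 m n (X : 'M[C]_(m, n)) :
  fnorm X ^+ 2 = \sum_i \sum_j normc (X i j) ^+ 2.
Proof.
by rewrite sqr_sqrtr//; do 2![apply: sumr_ge0 => ? _]; rewrite sqr_ge0.
Qed.

Lemma fnorm_eq2 m n p q (X : 'M[C]_(m, n)) (Y : 'M[C]_(p, q)) :
  fnorm X ^+ 2 = fnorm Y ^+ 2 -> fnorm X = fnorm Y.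
Proof. by move/eqP; rewrite eqrXn2 ?fnorm_ge0// => /eqP. Qed.

Lemma vnormE m (v : 'cV[C]_m) : vnorm v = fnorm v.
Proof.
by congr (Num.sqrt _); apply: eq_bigr => i _; rewrite big_ord1.
Qed.

Lemma normc_ge0 (z : C) : 0 <= normc z.
Proof. by case: z => a b; apply: sqrtr_ge0. Qed.

Lemma normc_conj (z : C) : normc (Num.conj z) = normc z.
Proof. by case: z => a b /=; rewrite sqrrN. Qed.

Lemma fnorm_adj m n (X : 'M[C]_(m, n)) : fnorm (X ^t*) = fnorm X.
Proof.
congr (Num.sqrt _); rewrite exchange_big; apply: eq_bigr => i _.
by apply: eq_bigr => j _; rewrite !mxE normc_conj.
Qed.

Lemma fnormN m n (X : 'M[C]_(m, n)) : fnorm (- X) = fnorm X.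
Proof.
congr (Num.sqrt _); apply: eq_bigr => i _; apply: eq_bigr => j _.
by rewrite mxE normcN.
Qed.

Lemma fnormZ m n a (X : 'M[C]_(m, n)) : fnorm (a *: X) = normc a * fnorm X.
Proof.
rewrite -[normc a]ger0_norm ?normc_ge0// -sqrtr_sqr -sqrtrM ?sqr_ge0//.
congr (Num.sqrt _); rewrite mulr_sumr; apply: eq_bigr => i _.
rewrite mulr_sumr; apply: eq_bigr => j _.
by rewrite mxE ComplexField.Normc.normcM exprMn.
Qed.

Lemma fnorm0 m n : fnorm (0 : 'M[C]_(m, n)) = 0.
Proof. by rewrite -(scale0r 0) fnormZ ComplexField.Normc.normc0 mul0r. Qed.

Lemma fnorm_eq0 m n (X : 'M[C]_(m, n)) : fnorm X = 0 -> X = 0.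
Proof.
move=> X0; have : fnorm X ^+ 2 = 0 by rewrite X0 expr0n.
rewrite fnorm2 => /eqP; rewrite psumr_eq0; last first.
  by move=> i _; apply: sumr_ge0 => j _; rewrite sqr_ge0.
move=> /allP Xi; apply/matrixP => i j; have /= := Xi i (mem_index_enum i).
rewrite psumr_eq0; last by move=> k _; rewrite sqr_ge0.
move=> /allP/(_ j (mem_index_enum j))/=; rewrite sqrf_eq0 => /eqP.
by move/ComplexField.Normc.eq0_normc ->; rewrite mxE.
Qed.

Lemma fnormD m n (X Y : 'M[C]_(m, n)) : fnorm (X + Y) <= fnorm X + fnorm Y.
Proof.
rewrite -(@ler_pXn2r _ 2) ?nnegrE ?addr_ge0 ?fnorm_ge0//.
rewrite sqrrD !fnorm2 !pair_big/=.
have := CauchySchwarz_sum (fun p : 'I_m * 'I_n => normc (X p.1 p.2))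
  (fun p => normc (Y p.1 p.2)).
rewrite /fnorm !pair_big/= => CS.
apply: le_trans (_ : \sum_p (normc (X p.1 p.2) + normc (Y p.1 p.2)) ^+ 2 <= _).
  apply: ler_sum => -[i j] _ /=; rewrite mxE ler_pXn2r ?nnegrE ?addr_ge0 ?normc_ge0//.
  exact: le_normcD.
under [leLHS]eq_bigr do rewrite sqrrD.
by rewrite !big_split/= lerD2r lerD2l mulr2n lerD.
Qed.

Lemma normc_sum (I : finType) (z : I -> C) : normc (\sum_i z i) <= \sum_i normc (z i).
Proof.
elim/big_ind2: _ => [|x a y b xa yb|//]; first by rewrite ComplexField.Normc.normc0.
exact: le_trans (le_normcD _ _) (lerD xa yb).
Qed.

Lemma normc_mul_row_col n (x : 'rV[C]_n) (y : 'cV[C]_n) :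
  normc ((x *m y) 0 0) <= fnorm x * fnorm y.
Proof.
rewrite mxE; apply: le_trans (normc_sum _) _.
under eq_bigr do rewrite ComplexField.Normc.normcM.
rewrite /fnorm big_ord1; under [X in _ * Num.sqrt X]eq_bigr do rewrite big_ord1.
exact: CauchySchwarz_sum.
Qed.

Lemma fnorm_sqr n (x : 'rV[C]_n) : (fnorm x ^+ 2)%:C = (x *m x ^t*) 0 0.
Proof.
rewrite fnorm2 big_ord1 mxE rmorph_sum/=; apply: eq_bigr => i _.
by rewrite !mxE -sqr_normc/= rmorphXn/= normc_def; case: (x 0 i).
Qed.

Lemma fnorm2_row_mx m n p (X : 'M[C]_(m, n)) (Y : 'M[C]_(m, p)) :
  fnorm (row_mx X Y) ^+ 2 = fnorm X ^+ 2 + fnorm Y ^+ 2.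
Proof.
rewrite !fnorm2 -big_split/=; apply: eq_bigr => i _; rewrite big_split_ord/=.
by congr (_ + _); apply: eq_bigr => j _; rewrite ?row_mxEl ?row_mxEr.
Qed.

Lemma fnorm2_col_mx m n p (X : 'M[C]_(m, n)) (Y : 'M[C]_(p, n)) :
  fnorm (col_mx X Y) ^+ 2 = fnorm X ^+ 2 + fnorm Y ^+ 2.
Proof.
by rewrite -fnorm_adj -(fnorm_adj X) -(fnorm_adj Y) -fnorm2_row_mx tr_col_mx map_row_mx.
Qed.

Lemma fnorm2_mxrow m k (q_ : 'I_k -> nat) (X_ : forall j, 'M[C]_(m, q_ j)) :
  fnorm (\mxrow_j X_ j) ^+ 2 = \sum_j fnorm (X_ j) ^+ 2.
Proof.
under [RHS]eq_bigr do rewrite fnorm2.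
rewrite fnorm2 [RHS]exchange_big; apply: eq_bigr => i _.
rewrite sig_big_dep/= (reindex _ tagnat.sig_bij_on)/=.
by apply: eq_bigr => l _; rewrite !mxE.
Qed.

Lemma fnorm2_mxcol m k (q_ : 'I_k -> nat) (X_ : forall j, 'M[C]_(q_ j, m)) :
  fnorm (\mxcol_j X_ j) ^+ 2 = \sum_j fnorm (X_ j) ^+ 2.
Proof.
rewrite -(fnorm_adj (\mxcol_j X_ j)) tr_mxcol.
have -> : map_mx Num.conj (\mxrow_j (X_ j)^T) = \mxrow_j ((X_ j) ^t*).
  by apply/matrixP => i j; rewrite !mxE.
by rewrite fnorm2_mxrow; apply: eq_bigr => j _; rewrite fnorm_adj.
Qed.
End EuclideanNorm.

(** * Spectral norm bounds and the least singular value *)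

Section OperatorBound.
Variable R : realType.
Local Notation C := R[i].
Local Notation normc := (@ComplexField.Normc.normc R).
Local Open Scope sesquilinear_scope.
Local Open Scope classical_set_scope.

Lemma mul_adj m n p (X : 'M[C]_(m, n)) (Y : 'M[C]_(n, p)) :
  (X *m Y)^t* = Y^t* *m X^t*.
Proof. by rewrite trmx_mul map_mxM. Qed.

(* The spectral norm of [X] is at most [c]; rows are used because the
   transformations of the algorithm act on the left. *)
Definition op_bounded m n (X : 'M[C]_(m, n)) (c : R) :=
  forall x : 'rV_m, fnorm (x *m X) <= c * fnorm x.

(** For y = x X^H one has |y|^2 = y X x^H <= c |y| |x|, and |y| cancels. *)
Lemma op_bounded_adj m n (X : 'M[C]_(m, n)) c :
  0 <= c -> op_bounded X c -> op_bounded (X^t*) c.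
Proof.
move=> c0 Xc x; set y := x *m _.
have [y0|y0] := eqVneq (fnorm y) 0; first by rewrite y0 mulr_ge0 ?fnorm_ge0.
have yp : 0 < fnorm y by rewrite lt_neqAle eq_sym y0 fnorm_ge0.
rewrite -(ler_pM2l yp) -expr2.
have -> : fnorm y ^+ 2 = normc ((y *m X *m x^t*) 0 0).
  rewrite -mulmxA -[X in X *m x^t*]trmxCK -mul_adj -/y -fnorm_sqr/=.
  by rewrite expr0n/= addr0 sqrtr_sqr ger0_norm// sqr_ge0.
apply: le_trans (normc_mul_row_col _ _) _.
rewrite fnorm_adj mulrA; apply: ler_wpM2r; first exact: fnorm_ge0.
by rewrite mulrC; apply: Xc.
Qed.

Lemma op_bounded_col m n (X : 'M[C]_(m, n)) c : 0 <= c ->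
  op_bounded X c <-> forall v : 'cV_n, fnorm (X *m v) <= c * fnorm v.
Proof.
move=> c0; split=> [Xc v|Xc].
  by rewrite -fnorm_adj mul_adj -[fnorm v]fnorm_adj; apply: op_bounded_adj.
rewrite -[X]trmxCK; apply: op_bounded_adj => // x.
by rewrite -fnorm_adj mul_adj trmxCK -[fnorm x]fnorm_adj.
Qed.

(** Cauchy-Schwarz on each column. This is what makes the set defining [spec_norm] bounded, so that
    its supremum is meaningful. *)
Lemma op_bounded_fnorm m n (X : 'M[C]_(m, n)) : op_bounded X (fnorm X).
Proof.
move=> x; rewrite -(@ler_pXn2r _ 2) ?nnegrE ?mulr_ge0 ?fnorm_ge0//.
rewrite exprMn {1}fnorm2 big_ord1 -{1}(fnorm_adj X) fnorm2 mulr_suml.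
apply: ler_sum => j _.
have -> : (x *m X) 0 j = (x *m col j X) 0 0.
  by rewrite !mxE; apply: eq_bigr => i _; rewrite !mxE.
have -> : \sum_(i < m) normc ((X^t*) j i) ^+ 2 = fnorm (col j X) ^+ 2.
  by rewrite fnorm2; apply: eq_bigr => i _; rewrite big_ord1 !mxE normc_conj.
rewrite -exprMn ler_pXn2r ?nnegrE ?mulr_ge0 ?fnorm_ge0 ?normc_ge0//.
by rewrite mulrC; apply: normc_mul_row_col.
Qed.

Lemma spec_norm_has_sup m n (X : 'M[C]_(m, n)) :
  has_sup [set vnorm (X *m v) | v in [set v : 'cV[C]_n | vnorm v <= 1]].
Proof.
split; first by exists (vnorm (X *m 0)); exists 0 => //=; rewrite vnormE fnorm0.
exists (fnorm X) => _ [v /= v1 <-]; rewrite !vnormE in v1 *.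
have := (op_bounded_col X (fnorm_ge0 X)).1 (op_bounded_fnorm X) v.
move=> /le_trans; apply.
by rewrite ler_piMr// fnorm_ge0.
Qed.

Lemma spec_norm_ge0 m n (X : 'M[C]_(m, n)) : 0 <= spec_norm X.
Proof.
apply: le_trans (_ : vnorm (X *m 0) <= _).
  by rewrite vnormE fnorm_ge0.
apply: ub_le_sup; first by case: (spec_norm_has_sup X).
by exists 0 => //=; rewrite vnormE fnorm0.
Qed.

Lemma op_bounded_spec_norm m n (X : 'M[C]_(m, n)) : op_bounded X (spec_norm X).
Proof.
apply/op_bounded_col; first exact: spec_norm_ge0.
move=> v; have [/fnorm_eq0 ->|v0] := eqVneq (fnorm v) 0.
  by rewrite mulmx0 !fnorm0 mulr0.
have vp : 0 < fnorm v by rewrite lt_neqAle eq_sym v0 fnorm_ge0.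
rewrite -ler_pdivrMr// mulrC.
have nV : normc (fnorm v)^-1%:C = (fnorm v)^-1.
  by rewrite /= expr0n addr0 sqrtr_sqr ger0_norm// invr_ge0 fnorm_ge0.
apply: ub_le_sup; first by case: (spec_norm_has_sup X).
exists ((fnorm v)^-1%:C *: v) => /=.
  by rewrite vnormE fnormZ nV mulVf.
by rewrite vnormE -scalemxAr fnormZ nV.
Qed.

Lemma spec_norm_le m n (X : 'M[C]_(m, n)) c :
  0 <= c -> op_bounded X c -> spec_norm X <= c.
Proof.
move=> c0 /(op_bounded_col _ c0) Xc; apply: sup_le_ub.
  by case: (spec_norm_has_sup X).
move=> _ [v /= v1 <-]; rewrite !vnormE in v1 *.
by apply: le_trans (Xc v) _; rewrite ler_piMr.
Qed.

Lemma op_boundedW m n (X : 'M[C]_(m, n)) c d :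
  c <= d -> op_bounded X c -> op_bounded X d.
Proof.
by move=> cd Xc x; apply: le_trans (Xc x) _; rewrite ler_wpM2r ?fnorm_ge0.
Qed.

Lemma op_boundedD m n (X Y : 'M[C]_(m, n)) c d :
  op_bounded X c -> op_bounded Y d -> op_bounded (X + Y) (c + d).
Proof.
move=> Xc Yd x; rewrite mulmxDr mulrDl.
exact: le_trans (fnormD _ _) (lerD (Xc x) (Yd x)).
Qed.

Lemma op_boundedN m n (X : 'M[C]_(m, n)) c :
  op_bounded X c -> op_bounded (- X) c.
Proof. by move=> Xc x; rewrite mulmxN fnormN. Qed.

Lemma op_boundedM m n p (X : 'M[C]_(m, n)) (Y : 'M[C]_(n, p)) c d :
  0 <= d -> op_bounded X c -> op_bounded Y d -> op_bounded (X *m Y) (c * d).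
Proof.
move=> d0 Xc Yd x; rewrite mulmxA; apply: le_trans (Yd _) _.
by rewrite [c * d]mulrC -mulrA ler_wpM2l.
Qed.

Lemma op_bounded_col_mx m n p (X : 'M[C]_(m, n)) (Y : 'M[C]_(p, n)) c :
  op_bounded (col_mx X Y) c -> op_bounded X c /\ op_bounded Y c.
Proof.
move=> XYc; split=> x.
- have := XYc (row_mx x 0); rewrite mul_row_col mul0mx addr0.
  rewrite (_ : fnorm (row_mx x (0 : 'M_(1, p))) = fnorm x)//.
  by apply: fnorm_eq2; rewrite fnorm2_row_mx fnorm0 expr0n addr0.
- have := XYc (row_mx 0 x); rewrite mul_row_col mul0mx add0r.
  rewrite (_ : fnorm (row_mx (0 : 'M_(1, m)) x) = fnorm x)//.
  by apply: fnorm_eq2; rewrite fnorm2_row_mx fnorm0 expr0n add0r.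
Qed.


Lemma le_fnorm_row_mx m n p (X : 'M[C]_(m, n)) (Y : 'M[C]_(m, p)) :
  fnorm X <= fnorm (row_mx X Y) /\ fnorm Y <= fnorm (row_mx X Y).
Proof.
by split; rewrite -(@ler_pXn2r _ 2) ?nnegrE ?fnorm_ge0// fnorm2_row_mx
  ?lerDl ?lerDr sqr_ge0.
Qed.

(** The triangle inequality gives a + b instead of the sharp sqrt(a^2 + b^2); the constant 3 of the
    error bounds absorbs the loss. *)
Lemma op_bounded_col_mxD m1 m2 k (X : 'M[C]_(m1, k)) (Y : 'M[C]_(m2, k)) a b :
  0 <= a -> 0 <= b -> op_bounded X a -> op_bounded Y b ->
  op_bounded (col_mx X Y) (a + b).
Proof.
move=> a0 b0 Xa Yb x; rewrite -[x]hsubmxK mul_row_col mulrDl.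
apply: le_trans (fnormD _ _) _; apply: lerD.
- by apply: le_trans (Xa _) _; rewrite ler_wpM2l// (le_fnorm_row_mx _ _).1.
- by apply: le_trans (Yb _) _; rewrite ler_wpM2l// (le_fnorm_row_mx _ _).2.
Qed.

Lemma fnorm_unitary m n (x : 'rV[C]_m) (U : 'M[C]_(m, n)) :
  U \is unitarymx -> fnorm (x *m U) = fnorm x.
Proof.
move=> /unitarymxP UU; apply: fnorm_eq2; apply: complexI.
by rewrite !fnorm_sqr mul_adj mulmxA -(mulmxA x) UU mulmx1.
Qed.

(** The spectral theorem writes D^H D = P^H diag(d) P with P unitary, so |D v|^2 is the sum of d_i
    |w_i|^2 with w = (P v)^H, and every d_i is at least the infimum of the eigenvalues. *)
Lemma sigma_min_le m n (D : 'M[C]_(m, n)) (v : 'cV[C]_n) :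
  sigma_min D * fnorm v <= fnorm (D *m v).
Proof.
set S := [set l : R | eigenvalue (D^t* *m D) l%:C].
(* An eigenvector x gives l |x|^2 = |x D^H|^2, so l is real and nonnegative. *)
have eig_ge0 (l : C) : eigenvalue (D^t* *m D) l ->
    l = (complex.Re l)%:C /\ 0 <= complex.Re l.
  move=> /eigenvalueP[x xE x0].
  have /(congr1 (fun y => (y *m x^t*) 0 0)) /= := xE.
  rewrite mulmxA -(mulmxA (x *m D^t*)) -{2}[D]trmxCK -mul_adj -fnorm_sqr.
  rewrite -scalemxAl mxE -fnorm_sqr => lE.
  have xp : 0 < fnorm x ^+ 2.
    rewrite exprn_gt0// lt_neqAle fnorm_ge0 andbT eq_sym.
    by apply: contra_neq x0 => /fnorm_eq0.
  have -> : l = (fnorm (x *m D^t*) ^+ 2 / fnorm x ^+ 2)%:C.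
    rewrite rmorphM fmorphV/= lE mulfK//.
    by rewrite (inj_eq (@complexI _) _ 0) gt_eqF.
  by rewrite /= divr_ge0// sqr_ge0.
have Slb : has_lbound S.
  by exists 0 => l /= /eig_ge0[].
(* Without columns there is no eigenvalue and [inf] is taken over the empty set, but then v = 0. *)
have [n0|n_gt0] := posnP n.
  by subst n; rewrite [v]flatmx0 mulmx0 !fnorm0 mulr0.
set A := D^t* *m D.
have AH : A^t* = A by rewrite /A mul_adj trmxCK.
have /orthomx_spectralP AE : A \is normalmx by apply/normalmxP; rewrite AH.
set P := spectralmx A in AE; set d := spectral_diag A in AE.
have PU : P \is unitarymx by exact: spectral_unitarymx.
have PV : P \in unitmx := unitarymx_unit PU.
have d_eig i : eigenvalue A (d 0 i).
  apply/eigenvalueP; exists (row i P); last first.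
    apply: contraTneq PV => Pi0; rewrite -row_free_unit; apply/row_freePn.
    by exists i; rewrite Pi0 sub0mx.
  rewrite {1}AE -row_mul !mulmxA mulmxV// mul1mx row_mul row_diag_mx.
  by rewrite -scalemxAl -rowE.
have S_ge0 l : S l -> 0 <= l by move=> /eig_ge0[].
have inf0 : 0 <= inf S.
  apply: lb_le_inf => //; exists (complex.Re (d 0 (Ordinal n_gt0))).
  by rewrite /S/= -(eig_ge0 _ (d_eig _)).1.
have inf_le i : inf S <= complex.Re (d 0 i).
  by apply: ge_inf => //; rewrite /S/= -(eig_ge0 _ (d_eig i)).1.
rewrite -(@ler_pXn2r _ 2) ?nnegrE ?mulr_ge0 ?sqrtr_ge0 ?fnorm_ge0//.
rewrite /sigma_min -/S exprMn sqr_sqrtr// -lecR.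
move: (inf S) inf0 inf_le => s s0 s_le.
have -> : fnorm v = fnorm (v^t* *m P^t*).
  by rewrite fnorm_unitary ?trmxC_unitary// fnorm_adj.
rewrite -[fnorm (D *m v)]fnorm_adj fnorm_sqr trmxCK mul_adj mulmxA.
rewrite -(mulmxA (v^t*)) -/A.
rewrite AE invmx_unitary// !mulmxA -(mulmxA _ P v) -[P *m v]trmxCK mul_adj.
move: (v^t* *m P^t*) => w.
rewrite mxE fnorm2 big_ord1 mulr_sumr rmorph_sum; apply: ler_sum => i _.
rewrite mul_mx_diag !mxE mulrAC -sqr_normc [leRHS]mulrC.
have [-> d0] := eig_ge0 _ (d_eig i).
rewrite rmorphM/=; apply: ler_pM => //.
- by rewrite ler0c.
- by rewrite ler0c sqr_ge0.
- by rewrite lecR.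
- by rewrite rmorphXn normc_def; case: (w 0 i).
Qed.
End OperatorBound.

(** * Moving a matrix into the left kernel of D *)

Section KernelCorrection.
Variable R : realType.
Local Notation C := R[i].
Local Open Scope sesquilinear_scope.

Lemma mulmx_colP m n (X Y : 'M[C]_(m, n)) :
  (forall v : 'cV_n, X *m v = Y *m v) -> X = Y.
Proof.
move=> XY; apply/matrixP => i j; have := XY (delta_mx j 0).
by rewrite -!colE => /matrixP/(_ i 0); rewrite !mxE.
Qed.

(* The correction [W0 - W] is [- W D D^+], with [D^+ = (D^* D)^-1 D^*]. *)
Lemma left_kernel_correction m q n (D : 'M[C]_(m, q)) (W : 'M[C]_(n, m)) s e :
  0 < s -> (forall v : 'cV_q, s * fnorm v <= fnorm (D *m v)) ->
  op_bounded (W *m D) e ->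
  exists2 W0 : 'M_(n, m), W0 *m D = 0 & op_bounded (W0 - W) (e / s).
Proof.
move=> s0 sD We; set A := D^t* *m D.
have Au : A \in unitmx.
  rewrite -row_free_unit; apply: inj_row_free => x xA.
  have /eqP : fnorm (D *m x^t*) = 0.
    apply/eqP; rewrite -sqrf_eq0 -(inj_eq (@complexI R)) -fnorm_adj fnorm_sqr.
    by rewrite trmxCK mul_adj trmxCK mulmxA -(mulmxA x) xA mul0mx mxE.
  move=> Dx; have := sD (x^t*); rewrite (eqP Dx) fnorm_adj pmulr_rle0// => x0.
  by apply: fnorm_eq0; apply/eqP; rewrite eq_le x0 fnorm_ge0.
exists (W - W *m D *m invmx A *m D^t*).
  by rewrite mulmxBl -!mulmxA mulVmx// mulmx1 subrr.
move=> x; rewrite addrAC subrr add0r mulmxN fnormN !mulmxA.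
set g := x *m W *m D; set h := (g *m invmx A)^t*.
have cE : g *m invmx A *m D^t* = (D *m h)^t* by rewrite mul_adj trmxCK.
rewrite cE fnorm_adj; set c := fnorm (D *m h).
have gx : fnorm g <= e * fnorm x by rewrite /g -mulmxA; apply: We.
(* Since g = h^H D^H D, one has c^2 = |D h|^2 = g h <= |g| |h|, while s |h| <= |D h| = c. Cancelling
   c bounds the correction by |g| / s. *)
have c2 : c ^+ 2 <= fnorm g * (c / s).
  have -> : c ^+ 2 = ComplexField.Normc.normc ((g *m h) 0 0).
    rewrite -[g in RHS](mulmxKV Au) -[g *m invmx A]trmxCK -/h /A mulmxA.
    rewrite -mul_adj -(mulmxA _ D) -[D *m h in X in _ *m X]trmxCK -fnorm_sqr fnorm_adj/=.
    by rewrite expr0n/= addr0 sqrtr_sqr ger0_norm// sqr_ge0.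
  apply: le_trans (normc_mul_row_col _ _) _; rewrite ler_wpM2l ?fnorm_ge0//.
  by rewrite ler_pdivlMr// mulrC; apply: sD.
have [c0|cn0] := eqVneq c 0.
  by rewrite c0 mulrAC divr_ge0 ?(ltW s0)// (le_trans _ gx) ?fnorm_ge0.
have cp : 0 < c by rewrite lt_neqAle eq_sym cn0 fnorm_ge0.
rewrite mulrAC ler_pdivlMr//; apply: le_trans gx.
by rewrite -(ler_pM2l cp) mulrA -expr2 [c * _]mulrC -ler_pdivlMr// -mulrA.
Qed.

(** A dimension count: W kills both D and y, so the rank of (D y) is at most m - n = q, which is
    already the rank of D. *)
Lemma col_span_left_kernel m q n (D : 'M[C]_(m, q)) (W : 'M[C]_(n, m)) :
  (q + n = m)%N -> W *m D = 0 ->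
  (forall x : 'rV_n, x *m W = 0 -> x = 0) ->
  (forall v : 'cV_q, D *m v = 0 -> v = 0) ->
  forall y : 'cV_m, W *m y = 0 -> exists v, y = D *m v.
Proof.
move=> qnm WD Winj Dinj y Wy.
have rW : \rank W = n by apply/eqP; apply: inj_row_free.
have rD : \rank D^T = q.
  apply/eqP; apply: inj_row_free => v vD; apply: trmx_inj; rewrite trmx0.
  by apply: Dinj; rewrite -[D]trmxK -trmx_mul vD trmx0.
have DX : (D^T <= col_mx D^T y^T)%MS by rewrite -addsmxE addsmxSl.
have : W *m row_mx D y = 0 by rewrite mul_mx_row WD Wy row_mx0.
move=> /mulmx0_rank_max; rewrite rW -mxrank_tr tr_row_mx => rk.
have Xle : (\rank (col_mx D^T y^T) <= \rank D^T)%N.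
  by rewrite rD -(leq_add2l n) (addnC n q) qnm.
have XD : (col_mx D^T y^T <= D^T)%MS.
  by rewrite -(geq_leqif (mxrank_leqif_sup DX)).
have /submxP[c yE] : (y^T <= D^T)%MS.
  by apply: submx_trans XD; rewrite -addsmxE addsmxSr.
by exists c^T; rewrite -[LHS]trmxK yE trmx_mul trmxK.
Qed.
End KernelCorrection.

(** * Powers of a pencil from a left kernel basis *)

Section PencilPowers.
Variables (R : realType) (n : nat).
Local Notation C := R[i].
Implicit Types A B : 'M[C]_n.

Lemma mxrow_mul_IRS_mx m A B p (W : nat -> 'M[C]_(m, n)) :
  (\mxrow_(i < (2 ^ p)%N) W i) *m IRS_mx A B p =
  \mxrow_(j < (2 ^ p - 1)%N) (W j *m B - W j.+1 *m A).
Proof.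
rewrite /IRS_mx mul_mxrow_mxblock; apply: eq_mxrow => j.
have jN : (j < 2 ^ p)%N by apply: leq_trans (ltn_ord j) (leq_subr _ _).
have j1N : (j.+1 < 2 ^ p)%N by have := ltn_ord j; rewrite ltn_subRL add1n.
rewrite (bigD1 (Ordinal jN))//= eqxx (bigD1 (Ordinal j1N))/=; last first.
  by rewrite -val_eqE /= eqn_leq ltnn.
rewrite eqn_leq ltnn /= eqxx mulmxN big1 ?addr0// => i.
by rewrite -!val_eqE /= => /andP[/negPf-> /negPf->]; rewrite mulmx0.
Qed.

(** The residuals of a chain f_0, ..., f_N with N = 2^p: the interior terms enter through D, the two
    ends through a vector supported on the first and last blocks. Hence a chain with prescribed ends
    exists exactly when that vector lies in the range of D. *)
Lemma IRS_mx_mul_mxcol A B p (f : nat -> 'cV[C]_n) :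
  \mxcol_(i < (2 ^ p)%N) (B *m f i.+1 - A *m f i) =
  IRS_mx A B p *m \mxcol_(j < (2 ^ p - 1)%N) f j.+1 +
  \mxcol_(i < (2 ^ p)%N) ((if (i.+1 == 2 ^ p)%N then B *m f (2 ^ p)%N else 0)
     - (if i == 0 :> nat then A *m f 0 else 0)).
Proof.
rewrite /IRS_mx mul_mxblock_mxrow -mxcolD; apply: eq_mxcol => i.
transitivity (\sum_(j < 2 ^ p - 1 | j == i :> nat) B *m f j.+1
  - \sum_(j < 2 ^ p - 1 | (j.+1 == i :> nat)) A *m f j.+1 +
  ((if (i.+1 == 2 ^ p)%N then B *m f (2 ^ p)%N else 0)
     - (if i == 0 :> nat then A *m f 0 else 0))); last first.
  congr (_ + _); rewrite [X in X - _]big_mkcond [X in _ - X]big_mkcond/= -sumrB.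
  apply: eq_bigr => j _; rewrite [i == j :> nat]eq_sym [i == j.+1 :> nat]eq_sym.
  case: eqVneq => [->|_]; first by rewrite eqn_leq ltnn subr0.
  by case: eqVneq => _; rewrite ?mulNmx ?mul0mx sub0r ?oppr0.
have iN := ltn_ord i.
rewrite (big_ord1_eq _ (fun j => B *m f j.+1)) addrACA -opprD; congr (_ - _).
  rewrite ltn_subRL add1n; have [->|iN1] := eqVneq i.+1 (2 ^ p)%N.
    by rewrite ltnn add0r.
  by rewrite ltn_neqAle iN1 iN addr0.
case: (nat_of_ord i) iN => [|k] kN.
  by rewrite big_pred0 ?add0r.
by rewrite (big_ord1_eq _ (fun j => A *m f j.+1)) ltn_subRL add1n kN addr0.
Qed.

(** The rows of [Wr] span the left kernel of D, so the end vector of a chain from x to y lies in the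
    range of D iff [Wr] kills it, that is, iff W_(N-1) B x = W_0 A y. *)
Lemma quot_pow_eq_left_kernel A B p (W : nat -> 'M[C]_n)
    (Wr := \mxrow_(i < (2 ^ p)%N) W i) :
  Wr *m IRS_mx A B p = 0 ->
  (forall x : 'rV_n, x *m Wr = 0 -> x = 0) ->
  (forall v : 'cV_(\sum_(j < 2 ^ p - 1) n), IRS_mx A B p *m v = 0 -> v = 0) ->
  quot_pow_eq A B (2 ^ p) (W 0%N *m A) (W (2 ^ p - 1)%N *m B).
Proof.
move=> WD Winj Dinj; set N := (2 ^ p)%N.
have N0 : (0 < N)%N by rewrite expn_gt0.
have N1 : (N - 1).+1 = N by rewrite subn1 prednK.
have eqN k : (k.+1 == N) = (k == N - 1)%N by rewrite -[in LHS]N1 eqSS.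
have Wends (x y : 'cV[C]_n) : Wr *m \mxcol_(i < N)
    ((if (i.+1 == N)%N then B *m x else 0) - (if i == 0 :> nat then A *m y else 0))
    = W (N - 1)%N *m B *m x - W 0%N *m A *m y.
  rewrite /Wr mul_mxrow_mxcol; under eq_bigr do rewrite mulmxBr.
  rewrite sumrB; congr (_ - _).
    have lN : (N - 1 < N)%N by rewrite N1.
    rewrite (bigD1 (Ordinal lN))//= eqN eqxx mulmxA big1 ?addr0// => i.
    by rewrite -val_eqE /= => iN; rewrite eqN (negPf iN) mulmx0.
  rewrite (bigD1 (Ordinal N0))//= mulmxA big1 ?addr0// => i.
  by rewrite -val_eqE /= => /negPf ->; rewrite mulmx0.
have rel x y : quot_rel (W 0%N *m A) (W (N - 1)%N *m B) x y <->
    quot_rel_pow A B N x y.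
  split=> [xy|[z [z0 zN zk]]].
    have Wt := Wends x y; rewrite xy subrr in Wt.
    have Nn : ((\sum_(j < N - 1) n) + n = \sum_(i < N) n)%N.
      by rewrite !sum_nat_const !card_ord -[in RHS]N1 mulSn addnC.
    have [v tE] := col_span_left_kernel Nn WD Winj Dinj Wt.
    (* The end vector is D v, so the interior of the chain is -v. The indices of [f] run against
       those of [quot_rel_pow]: f_0 = y and f_N = x. *)
    pose v_ k := if insub k is Some j then submxcol v (j : 'I_(N - 1)) else 0.
    pose f k := if k == 0%N then y else if k == N then x else - v_ k.-1.
    have fE : \mxcol_(j < N - 1) f j.+1 = - v.
      rewrite -[v in RHS]submxcolK; apply/mxcolP => j; rewrite mxcolK.
      rewrite submxcolN mxcolK /f /v_/= insubT//= => jN.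
      rewrite ltn_eqF; last by rewrite -[X in (_ < X)%N]N1 ltnS.
      by congr (- submxcol v _); apply: val_inj.
    have := IRS_mx_mul_mxcol A B p f.
    have fN : f N = x by rewrite /f gtn_eqF// eqxx.
    rewrite fE mulmxN -[f 0%N]/y fN -tE addNr => fk0.
    exists (fun k => f (N - k)%N); split=> [||k kN].
    - by rewrite subn0.
    - by rewrite subnn.
    - rewrite /quot_rel; have iN : (N - k.+1 < N)%N by rewrite -subSn// subSS leq_subr.
      have /(congr1 (fun X => submxcol X (Ordinal iN))) := fk0.
      rewrite mxcolK submxcol0 -[nat_of_ord _]/(N - k.+1)%N -subSn// subSS.
      by move=> /eqP; rewrite subr_eq0 => /eqP.
  pose f k := z (N - k)%N.
  have := IRS_mx_mul_mxcol A B p f; rewrite {1}/f.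
  have -> : \mxcol_(i < N) (B *m z (N - i.+1)%N - A *m z (N - i)%N) = 0.
    apply/mxcolP => i; rewrite mxcolK submxcol0.
    have := zk (N - i.+1)%N; rewrite -subSn// subSS leq_subr => /(_ isT) ->.
    by rewrite subrr.
  move/(congr1 (mulmx Wr)); rewrite mulmx0 mulmxDr mulmxA WD mul0mx add0r.
  rewrite /f Wends subnn subn0 z0 zN => /esym/eqP; rewrite subr_eq0 => /eqP.
  by rewrite /quot_rel => ->.
split=> // Au.
have pow x y : quot_rel_pow A B N x y -> y = (invmx A *m B) ^+ N *m x.
  case=> z [<- <- zk].
  suff zE k : (k <= N)%N -> z k = (invmx A *m B) ^+ k *m z 0%N by apply: zE.
  elim: k => [|k IH] kN; first by rewrite expr0 mul1mx.
  rewrite exprS -[_ * _]/(_ *m _) -mulmxA -IH ?(ltnW kN)// -mulmxA.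
  by rewrite -(zk _ kN) mulKmx.
(* A kernel vector of W_0 A is related to 0, and for invertible A the relation is the graph of a
   linear map, so this vector is 0. *)
have A'u : W 0%N *m A \in unitmx.
  rewrite -unitmx_tr -row_free_unit; apply: inj_row_free => v vA.
  apply: trmx_inj; rewrite trmx0.
  have /pow -> : quot_rel_pow A B N 0 v^T; last by rewrite mulmx0.
  apply/rel; rewrite /quot_rel mulmx0 -[X in X *m _ = _]trmxK -trmx_mul vA.
  by rewrite trmx0.
split=> //; apply: mulmx_colP => x; apply: pow; apply/rel.
by rewrite /quot_rel -(mulmxA (invmx _)) mulKVmx.
Qed.
End PencilPowers.

(** * The condition number is at least 1 *)

Section FirstBlockColumn.
Variables (R : realType) (n : nat).
Implicit Types A B : 'M[R[i]]_n.

(** The first block column of D has the nonzero blocks B and -A, so D sends a nonzero w placed in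
    the first block to a vector of norm |(A; B) w|. *)
Lemma sigma_min_IRS_mx_le A B p : (0 < n)%N -> (0 < p)%N ->
  sigma_min (IRS_mx A B p) <= spec_norm (col_mx A B).
Proof.
move=> n0 p0; set N := (2 ^ p)%N.
have N1 : (1 < N)%N by rewrite -{1}(expn0 2) ltn_exp2l.
pose w : 'cV[R[i]]_n := delta_mx (Ordinal n0) 0.
have wp : 0 < fnorm w.
  rewrite lt_neqAle fnorm_ge0 andbT eq_sym.
  apply/eqP => /fnorm_eq0/matrixP/(_ (Ordinal n0) 0)/eqP.
  by rewrite !mxE !eqxx oner_eq0.
pose f k := if k == 1%N then w else 0.
rewrite -(ler_pM2r wp).
apply: le_trans (_ : fnorm (col_mx A B *m w) <= _); last first.
  apply: (op_bounded_col _ (spec_norm_ge0 _)).1.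
  exact: op_bounded_spec_norm.
have sum2 (F : nat -> R) : (forall i, (1 < i)%N -> F i = 0) ->
    \sum_(i < N) F i = F 0%N + F 1%N.
  move=> F0; rewrite -(subnKC N1) big_split_ord/= 2!big_ord_recl big_ord0 addr0.
  by rewrite [X in _ + X]big1 ?addr0// => i _; apply: F0; rewrite /= ltnS leq_addr.
have -> : fnorm (col_mx A B *m w) = fnorm (\mxcol_(i < N) (B *m f i.+1 - A *m f i)).
  apply: fnorm_eq2; rewrite mul_col_mx fnorm2_col_mx fnorm2_mxcol.
  rewrite (sum2 (fun i => fnorm (B *m f i.+1 - A *m f i) ^+ 2)).
    by rewrite /f/= !mulmx0 subr0 sub0r fnormN addrC.
  by move=> [|[|i]]// _; rewrite /f/= !mulmx0 subr0 fnorm0 expr0n.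
have -> : fnorm w = fnorm (\mxcol_(j < (N - 1)%N) f j.+1).
  apply: fnorm_eq2; rewrite fnorm2_mxcol.
  have N0 : (0 < N - 1)%N by rewrite subn_gt0.
  rewrite (bigD1 (Ordinal N0))//= big1 ?addr0// => -[[|j] jN]//= _.
  by rewrite /f/= fnorm0 expr0n.
rewrite IRS_mx_mul_mxcol -/N /f (gtn_eqF N1)/= !mulmx0.
rewrite [X in _ + X](_ : _ = 0) ?addr0; first exact: sigma_min_le.
by apply/mxcolP => i; rewrite mxcolK submxcol0 !if_same subr0.
Qed.
End FirstBlockColumn.

(** * Errors of a single squaring step *)

Section OneStep.
Variables (R : realType) (n : nat) (u mu : R).
Local Notation M := 'M[R[i]]_n.
Variable MM : M -> M -> M.
Variable QR : 'M[R[i]]_(n + n, n) -> 'M[R[i]]_(n + n) * 'M[R[i]]_(n + n, n).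
Hypotheses (MMa : MM_accurate u mu MM) (QRa : QR_accurate u mu QR).
Hypothesis d_ge0 : 0 <= mu * u.
Local Open Scope sesquilinear_scope.
Local Notation d := (mu * u).

(** U and V are the adjoints of the right blocks of the exactly unitary Q'. The second block row of
    Q'^H X' = T vanishes since T is upper triangular, so (U V) applied to (B; -A) leaves only the
    backward error X' - X. *)
Lemma QR_left_kernel (A B : M) (Q := (QR (col_mx B (- A))).1) :
  exists U V : M,
    [/\ forall x : 'rV_n, fnorm (x *m U) ^+ 2 + fnorm (x *m V) ^+ 2 = fnorm x ^+ 2,
        op_bounded ((ursubmx Q)^t* - U) d, op_bounded ((drsubmx Q)^t* - V) d
      & op_bounded (U *m B - V *m A) (d * spec_norm (col_mx B (- A)))].
Proof.
have := QRa (col_mx B (- A)); rewrite /Q.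
case: (QR _) => {}Q T /= [Tup [X' [Q' [Q'u X'E QQ' XX']]]].
exists ((ursubmx Q')^t*), ((drsubmx Q')^t*).
have rowE (x : 'rV[R[i]]_n) : row_mx (x *m (ursubmx Q')^t*) (x *m (drsubmx Q')^t*)
    = row_mx 0 x *m Q'^t*.
  by rewrite -{3}[Q']submxK tr_block_mx map_block_mx mul_row_block !mul0mx !add0r.
have rowN (x : 'rV[R[i]]_n) : fnorm (row_mx 0 x *m Q'^t*) = fnorm x.
  rewrite fnorm_unitary ?trmxC_unitary//; apply: fnorm_eq2.
  by rewrite fnorm2_row_mx fnorm0 expr0n add0r.
have QQ'a : op_bounded (Q^t* - Q'^t*) d.
  rewrite -opprB -map_mxB -[X in map_mx _ X]raddfB.
  apply/op_boundedN/op_bounded_adj => //.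
  by apply: op_boundedW QQ' (op_bounded_spec_norm _).
have sub (x : 'rV[R[i]]_n) : row_mx (x *m ((ursubmx Q)^t* - (ursubmx Q')^t*))
    (x *m ((drsubmx Q)^t* - (drsubmx Q')^t*)) = row_mx 0 x *m (Q^t* - Q'^t*).
  rewrite [in RHS]mulmxBr -rowE -{3}[Q]submxK tr_block_mx map_block_mx mul_row_block.
  by rewrite !mul0mx !add0r opp_row_mx add_row_mx !mulmxBr.
have row0 (x : 'rV[R[i]]_n) : fnorm (row_mx (0 : 'M_(1, n)) x) = fnorm x.
  by apply: fnorm_eq2; rewrite fnorm2_row_mx fnorm0 expr0n add0r.
split=> x.
- by rewrite -fnorm2_row_mx rowE rowN.
- apply: (le_trans (le_fnorm_row_mx _
    (x *m ((drsubmx Q)^t* - (drsubmx Q')^t*))).1).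
  by rewrite sub -(row0 x); apply: QQ'a.
- apply: (le_trans (le_fnorm_row_mx
    (x *m ((ursubmx Q)^t* - (ursubmx Q')^t*)) _).2).
  by rewrite sub -(row0 x); apply: QQ'a.
have -> : x *m ((ursubmx Q')^t* *m B - (drsubmx Q')^t* *m A) =
    - (row_mx 0 x *m Q'^t* *m (X' - col_mx B (- A))).
  rewrite [in RHS]mulmxBr X'E -(mulmxA (row_mx 0 x) _ (_ *m T)).
  rewrite (mulmxA (Q'^t*)) -(invmx_unitary Q'u).
  rewrite mulVmx ?unitarymx_unit// mul1mx invmx_unitary// opprB -rowE.
  rewrite mul_row_col mulmxN mulmxBr !mulmxA -{1}[T]vsubmxK mul_row_col mul0mx add0r.
  suff -> : dsubmx T = 0 by rewrite mulmx0 subr0.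
  apply/matrixP => i j; rewrite !mxE Tup//=.
  by apply: leq_trans (ltn_ord j) (leq_addr _ _).
rewrite fnormN -(rowN x); apply: op_boundedW XX' _ _; exact: op_bounded_spec_norm.
Qed.

(** The three terms are the rounding of the product, the deviation of P from U, and the inherited
    error of Y. *)
Lemma MM_step (P U Y Y0 : M) s e : 0 <= s -> 0 <= e ->
  op_bounded (P - U) d -> op_bounded U 1 ->
  op_bounded (Y - Y0) e -> op_bounded Y0 s ->
  op_bounded (MM P Y - U *m Y0) (d * (1 + d) * (s + e) + d * (s + e) + e).
Proof.
move=> s0 e0 PU U1 YY0 Y0s.
have Ys : op_bounded Y (s + e)
  by rewrite -[Y](subrK Y0) [s + e]addrC; apply: op_boundedD.
have P1 : op_bounded P (1 + d).
  by rewrite -[P](subrK U) [1 + d]addrC; apply: op_boundedD.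
have -> : MM P Y - U *m Y0 = (MM P Y - P *m Y) + (P - U) *m Y + U *m (Y - Y0).
  by rewrite mulmxBl mulmxBr !addrA !subrK.
have se0 : 0 <= s + e by rewrite addr_ge0.
apply: op_boundedD; last by rewrite -[e]mul1r; apply: op_boundedM.
apply: op_boundedD; last exact: op_boundedM.
apply: op_boundedW (op_bounded_spec_norm _); apply: le_trans (MMa _ _) _.
apply: ler_pM (spec_norm_le _ Ys) => //; last 1 first.
- by apply: ler_wpM2l => //; apply: spec_norm_le; rewrite ?addr_ge0.
- by rewrite mulr_ge0 ?spec_norm_ge0.
- exact: spec_norm_ge0.
Qed.
End OneStep.

(** Here d <= 1/100 and e <= 3 s / 100, so (2 + d)(s + e) <= 3 s. The first bound lets the error of
    the iterates grow linearly in k; the second is the increment from k^2 to (k + 1)^2. *)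
Lemma IRS_step_arith (R : realFieldType) (d s k : R)
    (e := 3%:R * d * s * k) :
  0 <= d -> 0 <= s -> 0 <= k -> 100%:R * d * (k + 1) <= 1 ->
  d * (1 + d) * (s + e) + d * (s + e) + e <= 3%:R * d * s * (k + 1) /\
  d * ((s + e) + (s + e)) + (e + e) <= 3%:R * d * s * (2%:R * k + 1).
Proof.
move=> d0 s0 k0 dk.
have kd0 : 0 <= k * d by rewrite mulr_ge0.
have e_le : e <= 3%:R / 100%:R * s.
  rewrite /e (_ : _ * k = (3%:R * (k * d)) * s); last by ring.
  by apply: ler_wpM2r => //; lra.
have e0 : 0 <= e by rewrite /e !mulr_ge0.
have sd : (2%:R + d) * (s + e) <= 3%:R * s.
  apply: le_trans (_ : 21%:R / 10%:R * (104%:R / 100%:R * s) <= _); last by lra.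
  by apply: ler_pM; lra.
have sd2 : 2%:R * (s + e) <= 3%:R * s by lra.
split.
- have := ler_wpM2l d0 sd; rewrite /e; lra.
- have := ler_wpM2l d0 sd2; rewrite /e; lra.
Qed.

(** * Error growth over the iterations *)

Section Iteration.
Variables (R : realType) (n : nat) (d s : R).
Local Notation M := 'M[R[i]]_n.
Variables (A B : M).
Variable MM : M -> M -> M.
Variable QR : 'M[R[i]]_(n + n, n) -> 'M[R[i]]_(n + n) * 'M[R[i]]_(n + n, n).
Hypotheses (MMa : MM_accurate 1 d MM) (QRa : QR_accurate 1 d QR).
Hypotheses (d_ge0 : 0 <= d) (s_ge0 : 0 <= s).
Hypotheses (As : op_bounded A s) (Bs : op_bounded B s).

(* [W] collects the left transformations of the first [k] steps, with each
   computed [Q] replaced by the nearby unitary factor.  A step replaces [W D]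
   by two copies of itself around a new block column. *)
Lemma IRS_invariant k : 100%:R * d * k%:R <= 1 ->
  exists W : nat -> M,
    [/\ forall x : 'rV_n, \sum_(i < 2 ^ k) fnorm (x *m W i) ^+ 2 = fnorm x ^+ 2,
        forall x : 'rV_n,
          \sum_(j < 2 ^ k - 1) fnorm (x *m (W j *m B - W j.+1 *m A)) ^+ 2
            <= (3%:R * d * s * k%:R ^+ 2) ^+ 2 * fnorm x ^+ 2,
        op_bounded ((IRS MM QR A B k).1 - W 0%N *m A) (3%:R * d * s * k%:R)
      & op_bounded ((IRS MM QR A B k).2 - W (2 ^ k - 1)%N *m B)
          (3%:R * d * s * k%:R)].
Proof.
elim: k => [|k IH] dk.
  exists (fun=> 1%:M); split.
  - by move=> x; rewrite big_ord1 mulmx1.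
  - by move=> x; rewrite big_ord0 mulr_ge0 ?sqr_ge0.
  - by move=> x; rewrite mul1mx subrr mulmx0 fnorm0 !mulr0 mul0r.
  - by move=> x; rewrite mul1mx subrr mulmx0 fnorm0 !mulr0 mul0r.
have k0 : (0 : R) <= k%:R by [].
have /IH[W [W1 WD WA WB]] : 100%:R * d * k%:R <= 1.
  by apply: le_trans dk; rewrite ler_wpM2l ?mulr_ge0// ler_nat.
rewrite -(natr1 k) in dk *.
have [] := IRS_step_arith d_ge0 s_ge0 k0 dk.
set e := 3%:R * d * s * k%:R in WA WB *.
have e0 : 0 <= e by rewrite /e !mulr_ge0.
set N := (2 ^ k)%N in W1 WD WB.
have N0 : (0 < N)%N by rewrite expn_gt0.
have N1 : (N - 1).+1 = N by rewrite subn1 prednK.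
move=> stepM stepQ.
rewrite /IRS iterS -/(IRS MM QR A B k).
case: (IRS MM QR A B k) WA WB => Ak Bk /= WA WB.
rewrite /IRS_step /=.
have d1 : 0 <= d * 1 by rewrite mulr1.
have [U [V [UV QU QV UVk]]] := QR_left_kernel QRa d1 Ak Bk.
have W_le i (x : 'rV_n) : (i < N)%N -> fnorm (x *m W i) <= fnorm x.
  move=> iN; rewrite -(@ler_pXn2r _ 2) ?nnegrE ?fnorm_ge0// -(W1 x).
  rewrite (bigD1 (Ordinal iN))//= lerDl.
  by apply: sumr_ge0 => j _; rewrite sqr_ge0.
have WsA : op_bounded (W 0%N *m A) s.
  move=> x; rewrite mulmxA; apply: le_trans (As _) _.
  by rewrite ler_wpM2l// W_le.
have WsB : op_bounded (W (N - 1)%N *m B) s.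
  move=> x; rewrite mulmxA; apply: le_trans (Bs _) _.
  by rewrite ler_wpM2l// W_le// -[X in (_ < X)%N]N1.
have U1 : op_bounded U 1.
  move=> x; rewrite mul1r -(@ler_pXn2r _ 2) ?nnegrE ?fnorm_ge0// -(UV x).
  by rewrite lerDl sqr_ge0.
have V1 : op_bounded V 1.
  move=> x; rewrite mul1r -(@ler_pXn2r _ 2) ?nnegrE ?fnorm_ge0// -(UV x).
  by rewrite lerDr sqr_ge0.
(* The new family lists U W_0, ..., U W_(N-1), V W_0, ..., V W_(N-1). Its 2N - 1 block columns split
   into N - 1 old ones times U, the one at the junction, and N - 1 old ones times V. *)
pose W' i := if (i < N)%N then U *m W i else V *m W (i - N)%N.
have W'l i : (i < N)%N -> W' i = U *m W i by rewrite /W' => ->.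
have W'r i : W' (N + i)%N = V *m W i.
  by rewrite /W' ltnNge leq_addr /= addKn.
have N2 : (2 ^ k.+1 = N + N)%N by rewrite expnS mul2n addnn.
have N21 : (2 ^ k.+1 - 1 = (N - 1) + (1 + (N - 1)))%N.
  by rewrite N2 add1n N1 addnC -addnBA.
have Nlast : (2 ^ k.+1 - 1 = N + (N - 1))%N by rewrite N2 addnBA.
exists W'; split.
- move=> x; rewrite N2 big_split_ord/= -(UV x) -(W1 (x *m U)) -(W1 (x *m V)).
  congr (_ + _); apply: eq_bigr => i _.
    by rewrite W'l// mulmxA.
  by rewrite W'r mulmxA.
- move=> x; pose F i := fnorm (x *m (W' i *m B - W' i.+1 *m A)) ^+ 2.
  rewrite N21 (eq_bigr (fun i => F (nat_of_ord i)))// 2!big_split_ord/=.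
  rewrite big_ord1 addn0.
  set m := 3%:R * d * s * (2%:R * k%:R + 1) in stepQ.
  set h := 3%:R * d * s * k%:R ^+ 2 in WD.
  have -> : 3%:R * d * s * (k%:R + 1) ^+ 2 = h + m by rewrite /h /m; ring.
  have F1 : \sum_(i < N - 1) F i <= h ^+ 2 * fnorm (x *m U) ^+ 2.
    apply: le_trans (WD (x *m U)); rewrite le_eqVlt; apply/orP; left; apply/eqP.
    apply: eq_bigr => i _; have iN : (i.+1 < N)%N by rewrite -[X in (_ < X)%N]N1 ltnS.
    by rewrite /F !W'l ?(ltnW iN)// -!mulmxA -mulmxBr mulmxA.
  have F3 : \sum_(i < N - 1) F (N - 1 + (1 + i))%N <= h ^+ 2 * fnorm (x *m V) ^+ 2.
    apply: le_trans (WD (x *m V)); rewrite le_eqVlt; apply/orP; left; apply/eqP.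
    apply: eq_bigr => i _; rewrite addnA addn1 N1 /F -addnS !W'r.
    by rewrite -!mulmxA -mulmxBr mulmxA.
  have F2 : F (N - 1)%N <= m ^+ 2 * fnorm x ^+ 2.
    rewrite /F N1 -{2}[N]addn0 W'r W'l; last by rewrite -[X in (_ < X)%N]N1.
    rewrite -exprMn ler_pXn2r ?nnegrE ?fnorm_ge0//; last first.
      by rewrite mulr_ge0 ?fnorm_ge0// /m !mulr_ge0// addr_ge0// mulr_ge0.
    move: x {F F1 F3}.
    have Ak_s : op_bounded Ak (s + e).
      by rewrite -[Ak](subrK (W 0%N *m A)) [s + e]addrC; apply: op_boundedD.
    have Bk_s : op_bounded Bk (s + e).
      by rewrite -[Bk](subrK (W (N - 1)%N *m B)) [s + e]addrC; apply: op_boundedD.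
    (* The junction column is compared with U B_k - V A_k, which the QR step makes small; the
       inherited errors of A_k and B_k add 2 e. *)
    have -> : U *m W (N - 1)%N *m B - V *m W 0%N *m A =
      (U *m Bk - V *m Ak) + (V *m (Ak - W 0%N *m A) - U *m (Bk - W (N - 1)%N *m B)).
      by rewrite !mulmxBr !mulmxA opprB addrA subrKA [RHS]addrC subrKA.
    apply: op_boundedW stepQ _; apply: op_boundedD.
      apply: op_boundedW UVk; rewrite mulr1 ler_wpM2l//.
      apply: spec_norm_le; first by rewrite !addr_ge0.
      by apply: op_bounded_col_mxD; rewrite ?addr_ge0//; apply: op_boundedN.
    apply: op_boundedD; last apply: op_boundedN.
      by rewrite -[e]mul1r; apply: op_boundedM.
    by rewrite -[e]mul1r; apply: op_boundedM.
  apply: le_trans (lerD F1 (lerD F2 F3)) _.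
  have h0 : 0 <= h by rewrite /h !mulr_ge0// sqr_ge0.
  have m0 : 0 <= m by rewrite /m !mulr_ge0// addr_ge0// mulr_ge0.
  (* By |x U|^2 + |x V|^2 = |x|^2 the two old parts together cost only h^2 |x|^2, and h^2 + m^2 <=
     (h + m)^2. *)
  rewrite addrCA -mulrDr UV addrC -mulrDl ler_wpM2r ?sqr_ge0// sqrrD.
  by rewrite lerD2r lerDl mulrn_wge0// mulr_ge0.
- rewrite W'l// -mulmxA; apply: op_boundedW stepM _.
  by have := MM_step MMa d1 s_ge0 e0 QU U1 WA WsA; rewrite mulr1.
- rewrite Nlast W'r -mulmxA; apply: op_boundedW stepM _.
  by have := MM_step MMa d1 s_ge0 e0 QV V1 WB WsB; rewrite mulr1.
Qed.
End Iteration.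

(** * Assembly of the forward error bound *)

Lemma op_bounded_submxrow (R : realType) m k (q_ : 'I_k -> nat)
    (X : 'M[R[i]]_(m, \sum_j q_ j)) c j :
  op_bounded X c -> op_bounded (submxrow X j) c.
Proof.
move=> Xc x; apply: le_trans (Xc x).
rewrite mul_submxrow -(@ler_pXn2r _ 2) ?nnegrE ?fnorm_ge0//.
have -> : fnorm (x *m X) ^+ 2 = \sum_i fnorm (submxrow (x *m X) i) ^+ 2.
  by rewrite -fnorm2_mxrow submxrowK.
rewrite [leRHS](bigD1 j)//= lerDl.
by apply: sumr_ge0 => i _; rewrite sqr_ge0.
Qed.

(** Only the product mu u enters the bounds; the form with parameters 1 and d gives both black boxes
    a common constant. *)
Lemma MM_accurateW (R : realType) n (u mu d : R) (MM : 'M[R[i]]_n -> _ -> _) :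
  mu * u <= d -> MM_accurate u mu MM -> MM_accurate 1 d MM.
Proof.
move=> le_d MMa X Y; apply: le_trans (MMa X Y) _.
by rewrite mulr1 !ler_wpM2r ?spec_norm_ge0.
Qed.

Lemma QR_accurateW (R : realType) n (u mu d : R)
    (QR : 'M[R[i]]_(n + n, n) -> 'M[R[i]]_(n + n) * 'M[R[i]]_(n + n, n)) :
  mu * u <= d -> QR_accurate u mu QR -> QR_accurate 1 d QR.
Proof.
move=> le_d QRa X; have := QRa X; case: (QR X) => Q T [Tup [X' [Q' [? ? QQ XX]]]].
split=> //; exists X', Q'; split=> //; rewrite mulr1; first exact: le_trans QQ _.
by apply: le_trans XX _; rewrite ler_wpM2r ?spec_norm_ge0.
Qed.

(** The error splits into the accumulated 3 d s p and the effect c s of moving W into the left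
    kernel of D, where c = 3 d s p^2 / sg. *)
Lemma IRS_forward_error (R : realType) (n p : nat) (A B : 'M[R[i]]_n) (d e : R)
    (s := spec_norm (col_mx A B)) (sg := sigma_min (IRS_mx A B p))
    (MM : 'M[R[i]]_n -> 'M[R[i]]_n -> 'M[R[i]]_n)
    (QR : 'M[R[i]]_(n + n, n) -> 'M[R[i]]_(n + n) * 'M[R[i]]_(n + n, n)) :
  0 <= d -> 0 < sg -> MM_accurate 1 d MM -> QR_accurate 1 d QR ->
  100%:R * d * p%:R <= 1 -> 3%:R * d * s * p%:R ^+ 2 / sg < 1 ->
  3%:R * d * s * p%:R + 3%:R * d * s * p%:R ^+ 2 / sg * s <= e ->
  exists Ap Bp : 'M[R[i]]_n,
    [/\ quot_pow_eq A B (2 ^ p) Ap Bp,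
        spec_norm ((IRS MM QR A B p).1 - Ap) <= e
      & spec_norm ((IRS MM QR A B p).2 - Bp) <= e].
Proof.
move=> d0 sg0 MMa QRa dp c1 le_e; set D := IRS_mx A B p.
have s0 : 0 <= s by exact: spec_norm_ge0.
have [As Bs] := op_bounded_col_mx (op_bounded_spec_norm (col_mx A B)).
have [W [W1 WD WA WB]] := IRS_invariant MMa QRa d0 s0 As Bs dp.
set h := 3%:R * d * s * p%:R ^+ 2 in c1 WD le_e.
set N := (2 ^ p)%N in W1 WB WD.
have h0 : 0 <= h by rewrite /h !mulr_ge0// sqr_ge0.
pose Wr := \mxrow_(i < N) W i.
have WrD : op_bounded (Wr *m D) h.
  move=> x; rewrite -(@ler_pXn2r _ 2) ?nnegrE ?mulr_ge0 ?fnorm_ge0// exprMn.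
  by rewrite mxrow_mul_IRS_mx mul_mxrow fnorm2_mxrow.
have Wr1 (x : 'rV_n) : fnorm (x *m Wr) = fnorm x.
  by apply: fnorm_eq2; rewrite mul_mxrow fnorm2_mxrow.
have [W0 W0D W0c] := left_kernel_correction sg0 (sigma_min_le D) WrD.
set c := h / sg in c1 W0c le_e.
have c0 : 0 <= c by rewrite divr_ge0// ltW.
pose W_ k := if insub k is Some i then submxrow W0 (i : 'I_N) else 0.
have W_ord (i : 'I_N) : W_ i = submxrow W0 i.
  by rewrite /W_ insubT//= => iN; congr submxrow; apply: val_inj.
have W_E : \mxrow_(i < N) W_ i = W0.
  by rewrite -[RHS]submxrowK; apply: eq_mxrow.
have W_c i : (i < N)%N -> op_bounded (W_ i - W i) c.
  move=> iN; have -> : W_ i - W i = submxrow (W0 - Wr) (Ordinal iN).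
    by rewrite submxrowB mxrowK (W_ord (Ordinal iN)).
  exact: op_bounded_submxrow.
exists (W_ 0%N *m A), (W_ (N - 1)%N *m B).
have N0 : (0 < N)%N by rewrite expn_gt0.
have close (Z Y : 'M_n) i : (i < N)%N -> op_bounded Y s ->
    op_bounded (Z - W i *m Y) (3%:R * d * s * p%:R) ->
    spec_norm (Z - W_ i *m Y) <= e.
  move=> iN Ys ZW; apply: le_trans le_e.
  apply: spec_norm_le; first by rewrite addr_ge0 ?(mulr_ge0 c0)// !mulr_ge0.
  have -> : Z - W_ i *m Y = (Z - W i *m Y) + - ((W_ i - W i) *m Y).
    by rewrite mulmxBl opprB addrA subrK.
  apply: op_boundedD => //; apply: op_boundedN.
  by apply: op_boundedM => //; apply: W_c.
split; last 2 first.
- exact: close.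
- by apply: close => //; rewrite subn1 prednK.
apply: quot_pow_eq_left_kernel; rewrite ?W_E//; last first.
- move=> v Dv; have := sigma_min_le D v; rewrite Dv fnorm0 pmulr_rle0// => v0.
  by apply: fnorm_eq0; apply/eqP; rewrite eq_le v0 fnorm_ge0.
(* If x W0 = 0 then |x| = |x Wr| <= c |x| with c < 1, so the corrected rows stay independent. *)
- move=> x xW; have := W0c x; rewrite mulmxBr xW sub0r fnormN Wr1 => cx.
  have : (1 - c) * fnorm x <= 0 by rewrite mulrBl mul1r subr_le0.
  rewrite pmulr_rle0 ?subr_gt0// => x0.
  by apply: fnorm_eq0; apply/eqP; rewrite eq_le x0 fnorm_ge0.
Qed.

Unset Implicit Arguments.

Theorem theorem2p6 (R : realType) (n p : nat) (A B : 'M[R[i]]_n)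
    (u eps : R) (mu_MM mu_QR : {poly R})
    (fl : arith_op -> R[i] -> R[i] -> R[i])
    (MM : 'M[R[i]]_n -> 'M[R[i]]_n -> 'M[R[i]]_n)
    (QR : 'M[R[i]]_(n + n, n) -> 'M[R[i]]_(n + n) * 'M[R[i]]_(n + n, n))
    (hp : (1 <= p)%N)
    (hu : 0 < u)
    (hfl : fp_arith u fl)
    (hMM : MM_accurate u mu_MM.[n%:R] MM)
    (hQR : QR_accurate u mu_QR.[n%:R] QR)
    (heps : 0 < eps < 1) :
  let mu := Num.max (Num.max mu_MM.[n%:R] mu_QR.[n%:R]) (Num.sqrt n%:R) in
  u <= eps / (324%:R * mu * kappa_IRS A B p
              * Num.max (p%:R ^+ 2 + 4%:R * p%:R - 5%:R) 1) ->
  exists Ap Bp : 'M[R[i]]_n,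
    [/\ quot_pow_eq A B (2 ^ p) Ap Bp,
        spec_norm ((IRS MM QR A B p).1 - Ap) <= eps * spec_norm (col_mx A B)
      & spec_norm ((IRS MM QR A B p).2 - Bp) <= eps * spec_norm (col_mx A B)].
Proof.
move=> mu; set m := Num.max _ 1; set k := kappa_IRS A B p.
have /andP[eps0 eps1] := heps.
have mu0 : 0 <= mu by rewrite le_max sqrtr_ge0 orbT.
have s0 : 0 <= spec_norm (col_mx A B) by exact: spec_norm_ge0.
have sg0 : 0 <= sigma_min (IRS_mx A B p) by exact: sqrtr_ge0.
have k0 : 0 <= k by rewrite mulr_ge0 ?invr_ge0.
have p1 : (1 : R) <= p%:R by rewrite ler1n.
(* For p >= 2 because 4 p >= 5; for p = 1 by the second entry 1 of the maximum. *)
have pm : p%:R ^+ 2 <= m.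
  have [p2|] := ltnP 1 p; last first.
    move=> p_le1; have -> : p = 1%N by apply/eqP; rewrite eqn_leq p_le1.
    by rewrite expr1n le_max lexx orbT.
  rewrite le_max -addrA lerDl subr_ge0 -(@natrM R) ler_nat.
  by rewrite (leq_trans (_ : 5 <= 4 * 2)%N)// leq_mul2l.
have m0 : 0 <= m by apply: le_trans pm; rewrite sqr_ge0.
move=> u_le.
(* A zero denominator would turn the hypothesis into u <= 0. Positivity then excludes a rank
   deficient D, and also n = 0, where the norm of (A; B) vanishes. *)
have den0 : 0 < 324%:R * mu * k * m.
  rewrite lt0r; apply/andP; split; last first.
    apply: mulr_ge0 m0; apply: mulr_ge0 k0; apply: mulr_ge0 mu0; exact: ler0n.
  apply/eqP => den0; by move: u_le; rewrite den0 invr0 mulr0 leNgt hu.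
have kn0 : k != 0 by apply: contraTneq den0 => ->; rewrite mulr0 mul0r ltxx.
have sgn0 : sigma_min (IRS_mx A B p) != 0.
  by apply: contraNneq kn0 => sgn0; rewrite /k /kappa_IRS sgn0 invr0 mul0r.
have sgp : 0 < sigma_min (IRS_mx A B p) by rewrite lt_neqAle eq_sym sgn0.
have n0 : (0 < n)%N.
  rewrite lt0n; apply: contra_neq kn0 => n0; rewrite /k /kappa_IRS.
  suff -> : spec_norm (col_mx A B) = 0 by rewrite mulr0.
  apply/eqP; rewrite eq_le s0 andbT; apply: spec_norm_le => // x.
  rewrite mul0r; suff -> : x *m col_mx A B = 0 by rewrite fnorm0.
  by move: (x *m _) => y; apply/matrixP => i j; have := leq_trans (ltn_ord j) (eq_leq n0).
have k1 : 1 <= k.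
  by rewrite /k /kappa_IRS mulrC ler_pdivlMr// mul1r sigma_min_IRS_mx_le.
set d := mu * u; have d0 : 0 <= d by rewrite mulr_ge0// ltW.
have d_le : 324%:R * (d * k * m) <= eps.
  rewrite (_ : _ * _ = u * (324%:R * mu * k * m)) -?ler_pdivlMr//.
  by rewrite /d; ring.
(* All requirements reduce to t <= eps / 324: as kappa >= 1 and p >= 1, d p <= t, so 100 d p <= 1,
   the correction is 3 t < 1, and the total relative error is at most 6 t <= eps. *)
set t := d * k * p%:R ^+ 2.
have t_le : 324%:R * t <= eps.
  apply: le_trans d_le; rewrite ler_wpM2l// /t ler_wpM2l// mulr_ge0//.
have dp_le : d * p%:R <= t.
  rewrite /t -mulrA ler_wpM2l// expr2 mulrA ler_peMl//.
  by apply: mulr_ege1.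
have dskE (q : R) : 3%:R * d * spec_norm (col_mx A B) * q
    / sigma_min (IRS_mx A B p) = 3%:R * (d * k * q).
  by rewrite /k /kappa_IRS; ring.
apply: (@IRS_forward_error R n p A B d) => //.
- by apply: MM_accurateW hMM; rewrite ler_wpM2r ?(ltW hu)// !le_max lexx.
- by apply: QR_accurateW hQR; rewrite ler_wpM2r ?(ltW hu)// !le_max lexx orbT.
- lra.
- rewrite dskE -/t; lra.
rewrite dskE -/t.
have -> : 3%:R * d * spec_norm (col_mx A B) * p%:R + 3%:R * t * spec_norm (col_mx A B)
  = (3%:R * (d * p%:R) + 3%:R * t) * spec_norm (col_mx A B) by ring.
rewrite ler_wpM2r//; lra.
Qed.
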